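(* Let $g:K\to L$ be a continuous surjection between compact spaces, let $f=P(g):P(K)\to P(L)$, let $U_1,\ldots,U_n$ be disjoint closed subsets of $K$, let $c_1,\ldots,c_n\geq 0$, and $$\mathcal{U}=\{\nu\in P(K) : \nu(U_i)>c_i,\ i=1,\ldots,n\}.$$ Then $$f(\mathcal{U})=\left\{\lambda\in P(L) : \lambda\Big(g\Big(\bigcup_{i\in A}U_i\Big)\Big)>\sum_{i\in A}c_i\ \text{ for all } A\subset\{1,\ldots,n\},\ A\neq\emptyset\right\}.$$
   Context: All compact spaces are Hausdorff. $P(K)$ is the space of Radon probability measures on $K$ with the weak$^*$ topology, and $P(g):P(K)\to P(L)$ is the push-forward map $P(g)(\nu)(B)=\nu(g^{-1}(B))$. ''Disjoint'' means pairwise disjoint. *)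

(* Defs.v *)
From HB Require Import structures.
From mathcomp Require Import all_boot all_order all_algebra.
From mathcomp Require Import all_classical all_reals all_analysis.

Set Implicit Arguments.
Unset Strict Implicit.
Unset Printing Implicit Defensive.

Import Order.TTheory GRing.Theory Num.Theory.

Local Open Scope classical_set_scope.
Local Open Scope ereal_scope.

Definition borel (T : topologicalType) : set (set T) := <<s @open T >>.

(* The measurable types of the library are pointed. To keep the empty space
   among the topological spaces below, T is pointed by an auxiliary element x0,
   on which the sigma-algebra does not depend. *)
Definition pointed_at (T : Type) (x0 : T) : Type := T.

HB.instance Definition _ (T : topologicalType) (x0 : T) :=
  Topological.copy (pointed_at x0) T.
HB.instance Definition _ (T : topologicalType) (x0 : T) :=
  isPointed.Build (pointed_at x0) x0.

Definition borelType (T : topologicalType) (x0 : T) :=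
  g_sigma_algebraType (@open (pointed_at x0)).

Lemma measurable_borelType (T : topologicalType) (x0 : T) :
  (measurable : set (set (borelType x0))) = @borel T.
Proof. by []. Qed.

(* A set function of the library is defined on all subsets and its values
   outside the sigma-algebra are unconstrained. They are set to 0 here, so that
   two elements are equal as soon as they agree on the Borel sets (see
   radon_probability_ext). *)
Record radon_probability (R : realType) (T : topologicalType) :=
  RadonProbability {
    radon_mass :> set T -> \bar R;
    radon_mass_probability : exists (x0 : T) (P : probability (borelType x0) R),
      forall B, borel B -> radon_mass B = P B;
    radon_mass_inner_regular : forall B, borel B -> radon_mass B =
      ereal_sup [set radon_mass C | C in [set C | compact C /\ C `<=` B]];
    radon_mass_notin_borel : forall B, ~ borel B -> radon_mass B = 0 }.

Lemma radon_probability_ext (R : realType) (T : topologicalType)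
    (mu nu : radon_probability R T) :
  (forall B, borel B -> mu B = nu B) -> mu = nu.
Proof.
case: mu => mu m1 m2 m3; case: nu => nu n1 n2 n3 /= munu.
have E : mu = nu.
  apply/funext => B; have [bB|bB] := pselect (borel B); first exact: munu.
  by rewrite m3// n3.
by case: nu / E n1 n2 n3 {munu} => *; congr RadonProbability; exact: Prop_irrelevance.
Qed.

Lemma closed_borel (T : topologicalType) (C : set T) : closed C -> borel C.
Proof.
move=> cC; rewrite -(setCK C) -setTD; apply: sigma_algebraCD.
by apply: sub_sigma_algebra; exact: closed_openC.
Qed.

Section radon_pushforward.
Context (R : realType) (K L : topologicalType) (g : K -> L).
Hypothesis hL : hausdorff_space L.
Hypothesis cg : continuous g.

Lemma borel_preimage (B : set L) : borel B -> borel (g @^-1` B).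
Proof.
move=> bB; apply: (bB [set B | borel (g @^-1` B)]); split => [|A oA].
- split=> [|A /= bA|F /= bF].
  + by rewrite /= preimage_set0; exact: sigma_algebra0.
  + by rewrite setTD preimage_setC -setTD; exact: sigma_algebraCD.
  + by rewrite preimage_bigcup; exact: sigma_algebra_bigcup.
- by apply: sub_sigma_algebra; move/continuousP : cg => /(_ A oA).
Qed.

Variable mu : radon_probability R K.

Let push (B : set L) : \bar R := if `[< borel B >] then mu (g @^-1` B) else 0.

Let pushE B : borel B -> push B = mu (g @^-1` B).
Proof. by move=> bB; rewrite /push; case: asboolP. Qed.

Let push_probability : exists (x0 : L) (P : probability (borelType x0) R),
  forall B, borel B -> push B = P B.
Proof.
have [x0 [P muP]] := radon_mass_probability mu; exists (g x0).
have mg : measurable_fun [set: borelType x0] (g : borelType x0 -> borelType (g x0)).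
  by move=> _ B mB; rewrite setTI; exact: borel_preimage.
exists (distribution P (mfun_Sub (mem_set mg))) => B bB.
by rewrite pushE// muP//; exact: borel_preimage.
Qed.

Let push_inner_regular B : borel B -> push B =
  ereal_sup [set push C | C in [set C | compact C /\ C `<=` B]].
Proof.
move=> bB; have [x0 [P muP]] := radon_mass_probability mu.
have mono X Y : borel X -> borel Y -> X `<=` Y -> mu X <= mu Y.
  by move=> bX bY XY; rewrite !muP//; apply: le_measure; rewrite ?inE.
have cb (C : set L) : compact C -> borel C.
  by move=> cC; apply: closed_borel; exact: compact_closed.
have bP := borel_preimage bB.
apply/eqP; rewrite eq_le; apply/andP; split.
  rewrite pushE// (radon_mass_inner_regular mu bP).
  apply: ge_ereal_sup => _ [C [cC CB] <-].
  have cgC : compact (g @` C).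
    by apply: continuous_compact => //; exact: continuous_subspaceT.
  have gCB : g @` C `<=` B by move=> _ [x /CB Bx <-].
  have bpC := borel_preimage (cb _ cgC).
  have [bC|bC] := pselect (borel C); last first.
    rewrite radon_mass_notin_borel//; apply: (@le_trans _ _ (push (g @` C))).
      by rewrite (pushE (cb _ cgC)) muP.
    by apply: ereal_sup_ubound; exists (g @` C).
  apply: (@le_trans _ _ (push (g @` C))).
    rewrite (pushE (cb _ cgC)); apply: mono => //; exact: preimage_image.
  by apply: ereal_sup_ubound; exists (g @` C).
apply: ge_ereal_sup => _ [C [cC CB] <-].
rewrite (pushE (cb _ cC)) pushE//; apply: mono => //; last exact: preimage_subset.
exact: borel_preimage (cb _ cC).
Qed.

Let push_notin_borel B : ~ borel B -> push B = 0.
Proof. by rewrite /push; case: asboolP. Qed.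

Definition radon_pushforward : radon_probability R L :=
  RadonProbability push_probability push_inner_regular push_notin_borel.

Lemma radon_pushforwardE (B : set L) :
  borel B -> radon_pushforward B = mu (g @^-1` B).
Proof. exact: pushE. Qed.

End radon_pushforward.

Arguments radon_pushforward {R K L g}.

(* Main.v *)
From HB Require Import structures.
Require Import Defs.
From mathcomp Require Import all_boot all_order all_algebra.
From mathcomp Require Import all_classical all_reals all_analysis.
From mathcomp Require Import ring lra.

(** If nu(U_i) > c_i for all i, then nu(g^-1 (g U_A)), where U_A is the union of
    the U_i with i in A, is at least nu(U_A), which by disjointness is the sum
    of the nu(U_i); so lambda = P(g)(nu) satisfies all the inequalities.

    For the converse, look at m0(C) = lambda(g(closure C)), for C any subset of
    K. It is monotone and submodular, m0(C u D) + m0(C n D) <= m0(C) + m0(D),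
    because closures and images commute with unions but only shrink
    intersections. As there are finitely many sets A, the strict inequalities
    leave room for some t > 0 such that x_i = c_i + t satisfies the Hall
    condition: x(A) <= m0(U_A) for all A.

    Zorn's lemma gives a minimal m <= m0 among the submodular capacities of the
    same total mass that satisfy the Hall condition. Minimality makes m
    additive ([minimal_capacity_modular]). Indeed, cutting m along a set C gives
    the capacity m_C(D) = m(D n C) + m(D u C) - m(C) <= m(D), and m is additive
    when m_C = m for all C. Moving a little from m to m_C can only break the
    Hall condition at a tight A, where m(U_A) = x(A). But cutting along U_A for
    a tight A keeps the Hall condition, so m is already additive against U_A,
    which says that m and m_C agree at U_A. Hence a small move is harmless, and
    m_C = m by minimality.

    The finitely additive m is then turned into a Radon probability nu, with
    nu >= m on closed sets and nu <= m on open sets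
    ([exists_radon_of_finitely_additive]): regularise m from inside by closed
    sets, then from outside by open sets, and apply Caratheodory's theorem.
    The first inequality gives nu(U_i) >= x_i > c_i. The second one,
    with the normality of L and the outer regularity of lambda, bounds
    nu(g^-1 E) by lambda(E) for E closed in L, and two Radon probabilities that
    compare on closed sets are equal. *)

Set Implicit Arguments.
Unset Strict Implicit.
Unset Printing Implicit Defensive.

Import Order.TTheory GRing.Theory Num.Theory.

Local Open Scope classical_set_scope.
Local Open Scope ereal_scope.

(** * Finitely additive measures below a submodular capacity *)

Section finitely_additive_minorant.
Local Open Scope ring_scope.
Variables (R : realType) (T : Type).
Implicit Types (m : set T -> R) (A B C : set T).

Definition submodular_capacity m := [/\ m set0 = 0,
  forall A B, A `<=` B -> m A <= m B &
  forall A B, m (A `|` B) + m (A `&` B) <= m A + m B].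

Lemma capacity_ge0 m A : submodular_capacity m -> 0 <= m A.
Proof. by case=> <- mono _; exact: mono. Qed.

(** Cutting T into C and its complement: inside C this is m, outside C it is the
    increment of m over C. It is the step of the greedy algorithm on
    polymatroids that serves C first. It equals m for every C exactly when m is
    additive. *)
Definition split_capacity m C : set T -> R :=
  fun D => m (D `&` C) + (m (D `|` C) - m C).

Lemma split_capacity_le m C D :
  submodular_capacity m -> split_capacity m C D <= m D.
Proof. by case=> _ _ /(_ D C); rewrite /split_capacity; lra. Qed.

Lemma split_capacity_setT m C : split_capacity m C setT = m setT.
Proof. by rewrite /split_capacity setTI setTU; ring. Qed.

Lemma submodular_split m C :
  submodular_capacity m -> submodular_capacity (split_capacity m C).
Proof.
move=> [m0 mono sub]; rewrite /split_capacity; split.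
- by rewrite set0I set0U m0; ring.
- move=> A B AB; rewrite lerD ?lerB//; apply: mono; first exact: setSI.
  exact: setSU.
- move=> A B; have := sub (A `&` C) (B `&` C); have := sub (A `|` C) (B `|` C).
  by rewrite -setIIl -setIUl -setUUl -setUIl; lra.
Qed.

Lemma submodular_convex m m' t : 0 <= t <= 1 ->
  submodular_capacity m -> submodular_capacity m' ->
  submodular_capacity (fun C => (1 - t) * m C + t * m' C).
Proof.
move=> /andP[t0 t1] [m0 mono sub] [m'0 mono' sub']; have t1' : 0 <= 1 - t by lra.
split=> [|A B AB|A B]; first by rewrite m0 m'0; ring.
- by rewrite lerD// ler_wpM2l// ?mono ?mono'.
- have := ler_wpM2l t1' (sub A B); have := ler_wpM2l t0 (sub' A B).
  by rewrite !mulrDr; lra.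
Qed.

(** The infimum of a chain is a limit along it, so the submodular inequality
    passes to it: of two members of the chain, the smaller one bounds the left
    side and is bounded by both terms of the right side. *)
Lemma submodular_chain_inf (S : set (set T -> R)) : S !=set0 ->
  (forall m, S m -> submodular_capacity m) ->
  (forall m m', S m -> S m' ->
    (forall C, m C <= m' C) \/ (forall C, m' C <= m C)) ->
  submodular_capacity (fun C => inf [set m C | m in S]).
Proof.
move=> [m1 Sm1] capS chain.
have lb C : has_lbound [set m C | m in S].
  by exists 0 => _ [m Sm <-]; apply: capacity_ge0; exact: capS.
have ne C : [set m C | m in S] !=set0 by exists (m1 C); exists m1.
have inf_le m C : S m -> inf [set m C | m in S] <= m C.
  by move=> Sm; apply: ge_inf => //; exists m.
split=> [|A B AB|A B].
- rewrite (_ : [set m set0 | m in S] = [set 0]) ?inf1//.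
  apply/seteqP; split=> [_ [m /capS[+ _ _] <-]//|_ ->].
  by exists m1 => //; case: (capS _ Sm1).
- apply: lb_le_inf => // _ [m Sm <-]; apply: (le_trans (inf_le _ _ Sm)).
  by case: (capS _ Sm) => _ + _; exact.
- rewrite -lerBlDr; apply: lb_le_inf => // _ [m Sm <-].
  rewrite lerBlDr -lerBlDl; apply: lb_le_inf => // _ [m' Sm' <-].
  rewrite lerBlDl.
  have [mm'|m'm] := chain _ _ Sm Sm'.
  + case: (capS _ Sm) => _ _ /(_ A B).
    have := inf_le _ (A `|` B) Sm; have := inf_le _ (A `&` B) Sm.
    by have := mm' B; lra.
  + case: (capS _ Sm') => _ _ /(_ A B).
    have := inf_le _ (A `|` B) Sm'; have := inf_le _ (A `&` B) Sm'.
    by have := m'm A; lra.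
Qed.

(** Used with a the slacks in finitely many inequalities and b the rates at
    which a perturbation consumes them: some positive amount of it is allowed
    when the tight inequalities are not affected. *)
Lemma exists_small_scale (I : finType) (a b : I -> R) :
  (forall i, 0 <= a i) -> (forall i, 0 <= b i) ->
  (forall i, a i = 0 -> b i = 0) ->
  exists2 t, 0 < t <= 1 & forall i, t * b i <= a i.
Proof.
move=> a0 b0 ab.
(* The 1 in the denominator covers b i = 0 and keeps t * b i <= a i. *)
pose q i := if a i == 0 then 1 else a i / (1 + b i).
have q0 i : 0 < q i.
  rewrite /q; case: eqVneq => // ai; rewrite divr_gt0 ?lt0r ?ai ?a0//.
  by rewrite paddr_eq0 ?oner_eq0 ?addr_ge0.
exists (\big[Num.min/1]_i q i).
  rewrite bigmin_le_id andbT; apply/bigmin_gtP; split=> // i _; exact: q0.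
move=> i; have [ai|ai] := eqVneq (a i) 0; first by rewrite ab// ai mulr0.
have le_q : \big[Num.min/1]_i q i <= q i by exact: bigmin_inf.
apply: (le_trans (ler_wpM2r (b0 i) le_q)); rewrite /q (negbTE ai).
have b1 : 0 < 1 + b i by have := b0 i; lra.
by rewrite -mulrA ler_piMr// mulrC ler_pdivrMr//; have := b0 i; lra.
Qed.

Section hall.
Variables (I : finType) (U : I -> set T) (x : I -> R).

Definition hall_condition m :=
  forall A : {set I}, \sum_(i in A) x i <= m (\bigcup_(i in [set` A]) U i).

Let UA (A : {set I}) := \bigcup_(i in [set` A]) U i.

(** Write x(J) for the sum of x over J. As m(U_A) = x(A), the value of the cut
    at U_B is at least x(A n B) + x(A u B) - x(A) = x(B). *)
Lemma hall_split_tight m (A : {set I}) : submodular_capacity m ->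
  hall_condition m -> m (UA A) = \sum_(i in A) x i ->
  hall_condition (split_capacity m (UA A)).
Proof.
move=> [_ mono _] hm tA B; rewrite /split_capacity -/(UA B) tA.
have UAU : UA B `|` UA A = UA (B :|: A)%SET.
  rewrite -bigcup_setU; congr (bigcup _ _); apply/seteqP.
  by split=> i /=; rewrite finset.in_setU => /orP.
have UAI : UA (B :&: A)%SET `<=` UA B `&` UA A.
  by move=> y [i /=]; rewrite finset.in_setI => /andP[iB iA] Uy; split; exists i.
have := mono _ _ UAI; have := hm (B :&: A)%SET; have := hm (B :|: A)%SET.
have sumUI : \sum_(i in (B :|: A)%SET) x i + \sum_(i in (B :&: A)%SET) x i
    = \sum_(i in A) x i + \sum_(i in B) x i.
  rewrite (big_setID A) finset.setIC finset.setKU finset.setDUl finset.setDv.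
  by rewrite finset.setU0 [\sum_(i in B) _](big_setID A)/=; ring.
rewrite -/(UA (B :|: A)%SET) -/(UA (B :&: A)%SET) -UAU.
by lra.
Qed.

(** By minimality, m is its own cut along U_A for every tight A, which makes m
    additive on the pair (U_A, C) for all C. The cut of m along C therefore
    has the value m(U_A) at every tight U_A, so that a small convex
    combination of m with this cut still satisfies the Hall condition. It lies
    below m, hence equals m by minimality, and so does the cut. *)
Lemma minimal_capacity_modular m :
  submodular_capacity m -> hall_condition m ->
  (forall m', submodular_capacity m' -> hall_condition m' ->
    m' setT = m setT -> (forall C, m' C <= m C) -> forall C, m C <= m' C) ->
  forall A B, m (A `|` B) + m (A `&` B) = m A + m B.
Proof.
move=> cm hm minm.
have tight_modular (A : {set I}) C : m (UA A) = \sum_(i in A) x i ->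
    split_capacity m C (UA A) = m (UA A).
  move=> tA.
  have /(_ C) : forall C, m C <= split_capacity m (UA A) C.
    apply: minm => [|||D]; [exact: submodular_split|exact: hall_split_tight|
      exact: split_capacity_setT|exact: split_capacity_le].
  have := @split_capacity_le m C (UA A) cm.
  by rewrite /split_capacity setIC setUC; lra.
move=> B C; have sub D := @split_capacity_le m C D cm.
have [|||t /andP[t0 t1] ht] := @exists_small_scale {set I}
    (fun J => m (UA J) - \sum_(i in J) x i)
    (fun J => m (UA J) - split_capacity m C (UA J)).
- by move=> J; rewrite subr_ge0; exact: hm.
- by move=> J; rewrite subr_ge0.
- by move=> J /subr0_eq/(tight_modular _ C) ->; rewrite subrr.
pose mt D := (1 - t) * m D + t * split_capacity m C D.
have mtE D : mt D = m D - t * (m D - split_capacity m C D) by rewrite /mt; ring.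
have mt_le D : mt D <= m D by rewrite mtE lerBlDr lerDl mulr_ge0 ?subr_ge0// ltW.
have : m B <= mt B.
  apply: minm => //.
  - by apply: submodular_convex => //; [rewrite ltW|exact: submodular_split].
  - by move=> J; rewrite mtE; have := ht J; rewrite -/(UA J); lra.
  - by rewrite mtE split_capacity_setT subrr mulr0 subr0.
rewrite mtE lerBrDr gerDl pmulr_rle0// => mB.
by have := sub B; move: mB; rewrite /split_capacity; lra.
Qed.

(** Zorn's lemma: the Hall condition consists of lower bounds on values, so it
    passes to the infimum of a chain, and a minimal element is additive. *)
Theorem exists_finitely_additive_minorant m0 :
  submodular_capacity m0 -> hall_condition m0 ->
  exists m : set T -> R, [/\ submodular_capacity m,
    forall A B, m (A `|` B) + m (A `&` B) = m A + m B,
    m setT = m0 setT, forall C, m C <= m0 C & hall_condition m].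
Proof.
move=> c0 h0.
pose P m := [/\ submodular_capacity m, hall_condition m, m setT = m0 setT &
  forall C, m C <= m0 C].
pose ge (s t : {m | P m}) := `[< forall C, sval t C <= sval s C >].
have Pm0 : P m0 by split.
have [|r s t /asboolP rs /asboolP st|S tS|[m Pm] maxm] :=
    @ZL_preorder {m | P m} (exist _ m0 Pm0) ge.
- by move=> s; apply/asboolP.
- by apply/asboolP => C; exact: le_trans (rs C).
(* The infimum of an empty set of reals is 0, so an empty chain is bounded by
   m0 instead. *)
- have [[s0 Ss0]|S0] := pselect (S !=set0); last first.
    by exists (exist _ m0 Pm0) => s Ss; exfalso; apply: S0; exists s.
  pose S' := [set sval s | s in S].
  have S'P m : S' m -> P m by move=> [s _ <-]; exact: (svalP s).
  have S'0 : S' !=set0 by exists (sval s0), s0.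
  have cS' : submodular_capacity (fun C => inf [set m C | m in S']).
    apply: submodular_chain_inf => // [m /S'P[]//|_ _ [s Ss <-] [t St <-]].
    by have [/asboolP|/asboolP] := tS _ _ Ss St; [right|left].
  have inf_le m C : S' m -> inf [set m C | m in S'] <= m C.
    move=> Sm; apply: ge_inf; last by exists m.
    by exists 0 => _ [m' /S'P[cm' _ _ _] <-]; exact: capacity_ge0.
  have Pinf : P (fun C => inf [set m C | m in S']).
    split=> // [J||C].
    + by apply: lb_le_inf => [|_ [m /S'P[_ hm _ _] <-]]; first exact: image_nonempty.
    + rewrite (_ : [set m setT | m in S'] = [set m0 setT]) ?inf1//.
      apply/seteqP; split=> [_ [m /S'P[_ _ + _] <-]//|_ ->].
      by have [m Sm] := S'0; exists m => //; have [] := S'P _ Sm.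
    + have [m Sm] := S'0; apply: (le_trans (inf_le _ C Sm)).
      by have [_ _ _] := S'P _ Sm.
  exists (exist _ _ Pinf) => s Ss; apply/asboolP => C /=.
  by apply: inf_le; exists s.
have [cm hm mT mle] := Pm; exists m; split=> //.
apply: minimal_capacity_modular => // m' cm' hm' m'T m'm C.
have Pm' : P m' by split=> // [|D]; [rewrite m'T|exact: le_trans (mle D)].
have /asboolP : ge (exist _ m' Pm') (exist _ m Pm) by apply: maxm; apply/asboolP.
exact.
Qed.
End hall.
End finitely_additive_minorant.

(** * Regularity and comparison of Radon probabilities *)

Section radon_probability_theory.
Variables (R : realType) (T : topologicalType).
Implicit Types (mu nu : radon_probability R T) (A B : set T).

Lemma open_borel A : open A -> borel A.
Proof. exact: sub_sigma_algebra. Qed.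

Lemma borelC A : borel A -> borel (~` A).
Proof. by move=> bA; rewrite -setTD; exact: sigma_algebraCD. Qed.

Lemma radon_fin mu A : borel A -> mu A \is a fin_num.
Proof.
by move=> bA; have [x0 [P muP]] := radon_mass_probability mu; rewrite muP// fin_num_measure.
Qed.

Lemma radon_mono mu A B : borel A -> borel B -> A `<=` B -> mu A <= mu B.
Proof.
move=> bA bB AB; have [x0 [P muP]] := radon_mass_probability mu.
by rewrite !muP//; apply: le_measure; rewrite ?inE.
Qed.

Lemma radonC mu A : borel A -> mu (~` A) = 1 - mu A.
Proof.
move=> bA; have [x0 [P muP]] := radon_mass_probability mu.
by rewrite !muP ?probability_setC//; exact: borelC.
Qed.

Lemma radon0 mu : mu set0 = 0.
Proof.
have [x0 [P muP]] := radon_mass_probability mu.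
by rewrite muP ?measure0//; exact: sigma_algebra0.
Qed.

Lemma radonT mu : mu setT = 1.
Proof. by rewrite -setC0 radonC ?radon0 ?sube0//; exact: sigma_algebra0. Qed.

Lemma radon_modular mu A B : closed A -> closed B ->
  mu (A `|` B) + mu (A `&` B) = mu A + mu B.
Proof.
move=> cA cB; have [x0 [P muP]] := radon_mass_probability mu.
have [bA bB] := (closed_borel cA, closed_borel cB).
have bI := closed_borel (closedI cA cB); have bU := closed_borel (closedU cA cB).
rewrite !muP// measureUfinr ?subeK//; last by rewrite -ge0_fin_numE// fin_num_measure.
exact: fin_num_measure.
Qed.

Lemma radon_closed_outer_regular mu A (e : R) : hausdorff_space T -> closed A ->
  (0 < e)%R -> exists O, [/\ open O, A `<=` O & mu O <= mu A + e%:E].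
Proof.
move=> hT cA e0; have bA := closed_borel cA.
have : mu (~` A) - e%:E < mu (~` A).
  by rewrite lteBlDr// lteDl ?lte_fin// radon_fin//; exact: borelC.
rewrite [in ltRHS]radon_mass_inner_regular; last exact: borelC.
move=> /ereal_sup_gt[_ [C [cC CA] <-]].
have {}cC := compact_closed hT cC; have bC := closed_borel cC.
move=> /ltW AC; exists (~` C); split; [exact: closed_openC|exact: subsetCr|].
move: AC; rewrite !radonC//.
rewrite -(fineK (radon_fin mu bC)) -(fineK (radon_fin mu bA)).
by rewrite -!EFinB -EFinD !lee_fin; lra.
Qed.

(** By inner regularity the comparison extends to all Borel sets; applied to
    complements it becomes an equality, since the total masses agree. *)
Lemma radon_eq_of_le_closed mu nu : hausdorff_space T ->
  (forall C, closed C -> mu C <= nu C) -> mu = nu.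
Proof.
move=> hT le_closed.
have le_borel B : borel B -> mu B <= nu B.
  move=> bB; rewrite !radon_mass_inner_regular//.
  apply: ge_ereal_sup => _ [C [cC CB] <-]; apply: le_ereal_sup_tmp.
  by exists (nu C); [exists C|apply: le_closed; exact: compact_closed].
apply: radon_probability_ext => B bB; apply/eqP; rewrite eq_le le_borel//=.
have := le_borel _ (borelC bB); rewrite !radonC//.
rewrite -(fineK (radon_fin mu bB)) -(fineK (radon_fin nu bB)).
by rewrite -!EFinB !lee_fin; lra.
Qed.

Lemma radon_bigcup (n : nat) (U : 'I_n -> set T) (J : {set 'I_n}) mu :
  (forall i, closed (U i)) -> trivIset [set: 'I_n] U ->
  mu (\bigcup_(i in [set` J]) U i) = \sum_(i in J) mu (U i).
Proof.
move=> cU tU; have [x0 [P muP]] := radon_mass_probability mu.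
have bU i := closed_borel (cU i).
rewrite muP; last by apply: closed_borel; apply: closed_bigcup => //; exact: finite_finset.
rewrite (measure_fin_bigcup P)//.
- rewrite -(bigfs _ (index_enum_uniq _)) => [|i iJ]; last by rewrite mem_index_enum.
  by apply: eq_bigr => i _; rewrite muP.
- exact: sub_trivIset tU.
- by move=> i _; exact: bU.
Qed.

End radon_probability_theory.

(** * Radon probabilities from finitely additive ones *)

Section finitely_additive_to_radon.
Variables (R : realType) (T : topologicalType) (m : set T -> R).
Hypotheses (cT : compact [set: T]) (hT : hausdorff_space T).
Variable x0 : T.
Hypothesis m0 : m set0 = 0%R.
Hypothesis m_mono : forall A B, A `<=` B -> (m A <= m B)%R.
Hypothesis m_modular : forall A B,
  (m (A `|` B) + m (A `&` B) = m A + m B)%R.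

Definition inner_content (O : set T) : \bar R :=
  ereal_sup [set (m C)%:E | C in [set C | closed C /\ C `<=` O]].

Definition outer_extension (A : set T) : \bar R :=
  ereal_inf [set inner_content O | O in [set O | open O /\ A `<=` O]].

Let m_ge0 A : (0 <= m A)%R. Proof. by rewrite -m0; exact: m_mono. Qed.

Lemma le_inner_content C O : closed C -> C `<=` O -> (m C)%:E <= inner_content O.
Proof. by move=> cC CO; apply: ereal_sup_ubound; exists C. Qed.

Lemma inner_content_le O : inner_content O <= (m O)%:E.
Proof. by apply: ge_ereal_sup => _ [C [_ CO] <-]; rewrite lee_fin m_mono. Qed.

Lemma inner_content_ge0 O : 0 <= inner_content O.
Proof.
have -> : 0 = (m set0)%:E by rewrite m0.
by apply: le_inner_content => //; exact: closed0.
Qed.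

Lemma inner_content_mono A B : A `<=` B -> inner_content A <= inner_content B.
Proof.
move=> AB; apply: ge_ereal_sup => _ [C [cC CA] <-].
by apply: le_inner_content => //; exact: subset_trans AB.
Qed.

Lemma inner_content_fin O : inner_content O \is a fin_num.
Proof.
rewrite ge0_fin_numE ?inner_content_ge0//.
exact: le_lt_trans (inner_content_le O) (ltry _).
Qed.

(** Normality splits a closed C inside O1 u O2: V1 and V2 are disjoint
    neighbourhoods of C \ O1 and C \ O2, so C \ V1 and C \ V2 cover C and
    lie in O1 and O2. *)
Lemma inner_contentU O1 O2 : open O1 -> open O2 ->
  inner_content (O1 `|` O2) <= inner_content O1 + inner_content O2.
Proof.
move=> o1 o2; apply: ge_ereal_sup => _ [C [cC CO] <-].
have cD1 : closed (C `\` O1) by rewrite setDE; apply: closedI => //; exact: open_closedC.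
have cD2 : closed (C `\` O2) by rewrite setDE; apply: closedI => //; exact: open_closedC.
have D12 : (C `\` O1) `&` (C `\` O2) = set0.
  by apply/seteqP; split=> // t [[/CO Ot nO1t] [_ nO2t]]; case: Ot.
have /(@normal_openP R)/(_ _ _ cD1 cD2 D12) := compact_normal hT cT.
move=> [V1 [V2 [oV1 oV2 DV1 DV2 V12]]].
have C1 : C `\` V1 `<=` O1.
  by move=> t [Ct V1t]; apply: contrapT => O1t; apply: V1t; exact: DV1.
have C2 : C `\` V2 `<=` O2.
  by move=> t [Ct V2t]; apply: contrapT => O2t; apply: V2t; exact: DV2.
have CU : C = (C `\` V1) `|` (C `\` V2).
  by rewrite -setDIr V12 setD0.
apply: (@le_trans _ _ (m (C `\` V1) + m (C `\` V2))%R%:E).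
  by rewrite lee_fin {1}CU -m_modular lerDl.
rewrite EFinD; apply: leeD; apply: le_inner_content => //; rewrite setDE;
  apply: closedI => //; exact: open_closedC.
Qed.

Lemma inner_content_bigsetU (O : nat -> set T) n : (forall k, open (O k)) ->
  inner_content (\big[setU/set0]_(i < n) O i) <= \sum_(i < n) inner_content (O i).
Proof.
move=> oO; elim: n => [|n ih].
  by rewrite !big_ord0 (le_trans (inner_content_le _))// m0.
rewrite !big_ord_recr/=; apply: le_trans (inner_contentU _ _) _ => //.
  by rewrite -bigcup_mkord; apply: bigcup_open.
by rewrite leeD2r.
Qed.

(** Countable subadditivity comes from compactness: a closed set inside the
    union is covered by finitely many of the O k. *)
Lemma inner_content_bigcup (O : nat -> set T) : (forall k, open (O k)) ->
  inner_content (\bigcup_k O k) <= \sum_(k <oo) inner_content (O k).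
Proof.
move=> oO; apply: ge_ereal_sup => _ [C [cC CO] <-].
(* The cover characterisation of compactness concerns pointed spaces. *)
have : @compact (pointed_at x0) C by exact: subclosed_compact cT _.
rewrite compact_cover => /(_ _ setT O (fun k _ => oO k) CO)[D _ CD].
pose n := (\max_(i <- finmap.enum_fset D) i).+1.
apply: (@le_trans _ _ (\sum_(i < n) inner_content (O i))); last first.
  rewrite -(big_mkord xpredT (inner_content \o O)).
  by apply: nneseries_lim_ge => k _ _; exact: inner_content_ge0.
apply: le_trans (inner_content_bigsetU n oO); apply: le_inner_content => //.
rewrite -bigcup_mkord => t /CD[k /= kD Okt]; exists k => //=.
by rewrite ltnS; exact: leq_bigmax_seq.
Qed.

Lemma outer_extension_open O : open O -> outer_extension O = inner_content O.
Proof.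
move=> oO; apply/eqP; rewrite eq_le; apply/andP; split.
  by apply: ereal_inf_lbound; exists O => //; split=> //.
by apply: le_ereal_inf_tmp => _ [ O' [_ OO'] <-]; exact: inner_content_mono.
Qed.

Lemma outer_extension_closed C : closed C -> (m C)%:E <= outer_extension C.
Proof.
by move=> cC; apply: le_ereal_inf_tmp => _ [ O [_ CO] <-]; exact: le_inner_content.
Qed.

Lemma outer_extension_ge0 A : 0 <= outer_extension A.
Proof.
by apply: le_ereal_inf_tmp => _ [ O _ <-]; exact: inner_content_ge0.
Qed.

Lemma outer_extension0 : outer_extension set0 = 0.
Proof.
rewrite outer_extension_open; last exact: open0.
apply/eqP; rewrite eq_le inner_content_ge0 andbT.
by rewrite (le_trans (inner_content_le _))// m0.
Qed.

Lemma outer_extension_mono A B :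
  A `<=` B -> outer_extension A <= outer_extension B.
Proof.
move=> AB; apply: ereal_inf_le_tmp => _ [ O [oO BO] <-].
by exists O => //; split=> //; exact: subset_trans BO.
Qed.

Lemma outer_extension_fin A : outer_extension A \is a fin_num.
Proof.
rewrite ge0_fin_numE ?outer_extension_ge0//.
apply: (le_lt_trans (outer_extension_mono (@subsetT _ A))).
rewrite outer_extension_open; last exact: openT.
by rewrite -ge0_fin_numE ?inner_content_ge0// inner_content_fin.
Qed.

Lemma outer_extension_approx A (e : R) : (0 < e)%R ->
  exists O, [/\ open O, A `<=` O & inner_content O <= outer_extension A + e%:E].
Proof.
move=> e0.
have /ereal_inf_lt[_ [ O [oO AO] <-] /ltW] : outer_extension A < outer_extension A + e%:E.
  by rewrite lteDl ?outer_extension_fin// lte_fin.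
by exists O.
Qed.

Lemma outer_extension_sigma_subadditive : sigma_subadditive outer_extension.
Proof.
move=> A; apply/lee_addgt0Pr => e e0.
have /choice[ O hO] k : exists O, [/\ open O, A k `<=` O &
    inner_content O <= outer_extension (A k) + (e / (2 ^ k.+1)%:R)%:E].
  by apply: outer_extension_approx; rewrite divr_gt0// ltr0n expn_gt0.
apply: (@le_trans _ _ (inner_content (\bigcup_k O k))).
  apply: ereal_inf_lbound; exists (\bigcup_k O k) => //; split.
    by apply: bigcup_open => k _; have [] := hO k.
  by apply: subset_bigcup => k _; have [] := hO k.
apply: (le_trans (inner_content_bigcup _)); first by move=> k; have [] := hO k.
apply: le_trans (epsilon_trick xpredT (fun k => outer_extension_ge0 (A k)) (ltW e0)).
apply: lee_nneseries => [k _ _|k _]; first exact: inner_content_ge0.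
by have [] := hO k.
Qed.

(** By outer regularity X may be taken open, X = V. Exhaust V n O by a closed C
    and then the open set V \ C, which contains V \ O, by a closed D. Since C
    and D are disjoint, m(C) + m(D) = m(C u D), which the content of V bounds. *)
Lemma open_caratheodory O : open O ->
  forall X, outer_extension (X `&` O) + outer_extension (X `&` ~` O)
            <= outer_extension X.
Proof.
move=> oO X; apply: le_ereal_inf_tmp => _ [V [oV XV] <-].
apply: (@le_trans _ _ (outer_extension (V `&` O) + outer_extension (V `&` ~` O))).
  by apply: leeD; apply: outer_extension_mono; exact: setSI.
rewrite outer_extension_open; last exact: openI.
rewrite -leeBrDr ?outer_extension_fin//.
apply: ge_ereal_sup => _ [C [cC CVO] <-].
rewrite leeBrDr ?outer_extension_fin// addeC -leeBrDr//.
have oVC : open (V `&` ~` C) by apply: openI => //; exact: closed_openC.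
have VOC : V `&` ~` O `<=` V `&` ~` C.
  by move=> t [Vt nOt]; split=> // /CVO[].
apply: (le_trans (outer_extension_mono VOC)).
rewrite outer_extension_open//; apply: ge_ereal_sup => _ [D [cD DVC] <-].
rewrite leeBrDr// -EFinD addrC -m_modular.
have -> : C `&` D = set0 by apply/seteqP; split=> // t [Ct /DVC[]].
rewrite m0 addr0; apply: le_inner_content; first exact: closedU.
by move=> t [/CVO[]|/DVC[]].
Qed.

Hypothesis mT : m setT = 1%R.

Lemma outer_extension_setT : outer_extension setT = 1.
Proof.
rewrite outer_extension_open; last exact: openT.
by apply/eqP; rewrite eq_le -mT inner_content_le/= le_inner_content.
Qed.

Lemma outer_extension_probability : exists P : probability (borelType x0) R,
  forall B, P B = outer_extension B.
Proof.
pose mu : outer_measure R (borelType x0) := HB.pack outer_extension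
  (isOuterMeasure.Build R (borelType x0) outer_extension outer_extension0
     outer_extension_ge0 outer_extension_mono outer_extension_sigma_subadditive).
have sub B : borel B -> mu.-caratheodory B.
  move=> bB; apply: (bB mu.-caratheodory); split.
    split=> [|A mA|A mA]; first exact: caratheodory_measurable_set0.
      by rewrite setTD; exact: caratheodory_measurable_setC.
    exact: caratheodory_measurable_bigcup.
  by move=> O oO; apply: le_caratheodory_measurable; exact: open_caratheodory.
have sadd : semi_sigma_additive (outer_extension : set (borelType x0) -> \bar R).
  move=> A mA tA mUA.
  apply: (@caratheodory_measure_sigma_additive R (borelType x0) mu) => //.
    by move=> i; apply: sub; exact: mA.
  exact: sub.
pose M : measure (borelType x0) R :=
  HB.pack (outer_extension : set (borelType x0) -> \bar R)
   (isMeasure.Build _ (borelType x0) R (outer_extension : set (borelType x0) -> \bar R)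
     outer_extension0 outer_extension_ge0 sadd).
pose P : probability (borelType x0) R :=
  HB.pack (outer_extension : set (borelType x0) -> \bar R) (Measure.class M)
   (Measure_isProbability.Build _ (borelType x0) R M outer_extension_setT).
by exists P.
Qed.

(** The mass of nu on an open set is the inner content, which is at most m; on a
    closed set it is an infimum of inner contents, each at least m. Inner
    regularity at B is the outer regularity at the complement of B, as closed
    sets are compact. *)
Lemma exists_radon_of_finitely_additive : exists nu : radon_probability R T,
  (forall C, closed C -> (m C)%:E <= nu C) /\
  (forall O, open O -> nu O <= (m O)%:E).
Proof.
have [P PE] := outer_extension_probability.
pose mass B := if `[< borel B >] then outer_extension B else 0.
have massE B : borel B -> mass B = P B by rewrite /mass PE; case: asboolP.
have mass_notin B : ~ borel B -> mass B = 0 by rewrite /mass; case: asboolP.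
have ir B : borel B -> mass B =
    ereal_sup [set mass C | C in [set C | compact C /\ C `<=` B]].
  move=> bB; apply/eqP; rewrite eq_le; apply/andP; split; last first.
    apply: ge_ereal_sup => _ [C [cC CB] <-].
    have bC : borel C by apply: closed_borel; exact: compact_closed.
    by rewrite !massE// !PE; exact: outer_extension_mono.
  apply/lee_addgt0Pr => e e0.
  have [ O [oO BO OB]] := outer_extension_approx (~` B) e0.
  have bC : borel (~` O) by apply: closed_borel; exact: open_closedC.
  rewrite -leeBlDr//; apply: (@le_trans _ _ (mass (~` O))); last first.
    apply: ereal_sup_ubound; exists (~` O) => //; split.
      by apply: subclosed_compact cT _ => //; exact: open_closedC.
    by move=> t Ot; apply: contrapT => /BO.
  rewrite !massE// leeBlDr//.
  move: OB; rewrite -outer_extension_open// -!PE.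
  have bO := open_borel oO.
  rewrite [P (~` B)]probability_setC// [P (~` O)]probability_setC//.
  rewrite -(fineK (fin_num_measure P _ bO)) -(fineK (fin_num_measure P _ bB)).
  by rewrite -!EFinB -!EFinD !lee_fin; lra.
have massP : exists (x0 : T) (P : probability (borelType x0) R),
  forall B, borel B -> mass B = P B by exists x0, P.
exists (RadonProbability massP ir mass_notin); split=> [C cC|O oO] /=.
  by rewrite massE ?PE ?outer_extension_closed//; exact: closed_borel.
by rewrite massE ?PE ?outer_extension_open ?inner_content_le//; exact: open_borel.
Qed.

End finitely_additive_to_radon.

(** * Lifting a Radon probability along a map *)

Section lift.
Variables (R : realType) (K L : topologicalType).
Hypothesis cK : compact [set: K].
Hypotheses (cL : compact [set: L]) (hL : hausdorff_space L).
Variables (g : K -> L) (cg : continuous g).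

Lemma image_closed (C : set K) : closed C -> closed (g @` C).
Proof.
move=> cC; apply: compact_closed => //; apply: continuous_compact.
  exact: continuous_subspaceT.
exact: subclosed_compact cK _.
Qed.

(** The closure makes the image closed, hence Borel, for every subset C. *)
Definition image_capacity (lam : radon_probability R L) (C : set K) : R :=
  fine (lam (g @` closure C)).

Lemma image_capacityE lam C : closed C -> (image_capacity lam C)%:E = lam (g @` C).
Proof.
move=> cC; rewrite /image_capacity -(proj1 (closure_id _) cC) fineK//.
by apply: radon_fin; apply: closed_borel; exact: image_closed.
Qed.

Lemma image_capacity_submodular lam : submodular_capacity (image_capacity lam).
Proof.
have cgC (C : set K) : closed (g @` closure C) by exact/image_closed/closed_closure.
have bgC (C : set K) := closed_borel (cgC C).
have mono (A B : set L) : closed A -> closed B -> A `<=` B -> (fine (lam A) <= fine (lam B))%R.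
  move=> /closed_borel bA /closed_borel bB AB.
  by rewrite fine_le ?radon_fin//; exact: radon_mono.
split=> [|A B AB|A B].
- by rewrite /image_capacity closure0 image_set0 radon0.
- by apply: mono => //; apply: image_subset; exact: closure_subset.
- have := radon_modular lam (cgC A) (cgC B).
  have bI := closed_borel (closedI (cgC A) (cgC B)).
  have bU := closed_borel (closedU (cgC A) (cgC B)).
  rewrite -(fineK (radon_fin lam bI)) -(fineK (radon_fin lam bU)).
  rewrite -(fineK (radon_fin lam (bgC A))) -(fineK (radon_fin lam (bgC B))).
  move=> -[<-]; rewrite /image_capacity; apply: lerD.
    by rewrite closureU image_setU.
  apply: mono => //; first exact: closedI.
  by move=> _ [t tAB <-]; split; exists t => //; apply: closure_subset tAB => s [].
Qed.

(** Let E be closed in L, let O contain E with lambda(O) close to lambda(E), and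
    let V be an open neighbourhood of E with closure inside O. Then
    nu(g^-1 E) <= nu(g^-1 V) <= m(g^-1 V) <= lambda(closure of V) <= lambda(O). *)
Lemma pushforward_of_dominated (lam : radon_probability R L)
    (nu : radon_probability R K) (m : set K -> R) :
  (forall C, (m C <= image_capacity lam C)%R) ->
  (forall O, open O -> nu O <= (m O)%:E) ->
  radon_pushforward hL cg nu = lam.
Proof.
move=> m_le nu_le; apply: radon_eq_of_le_closed => // E cE.
have bE := closed_borel cE.
apply/lee_addgt0Pr => e e0.
have [ O [oO EO Oe]] := radon_closed_outer_regular lam hL cE e0.
apply: le_trans Oe.
have cO : closed (~` O) by exact: open_closedC.
have EO0 : E `&` ~` O = set0 by apply/disjoints_subset; rewrite setCK.
have /(@normal_openP R)/(_ _ _ cE cO EO0) := compact_normal hL cL.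
move=> [V [W [oV oW EV OW VW]]].
have oV' : open (g @^-1` V) by move/continuousP : cg; exact.
rewrite radon_pushforwardE//.
apply: (@le_trans _ _ (nu (g @^-1` V))).
  apply: radon_mono; [exact: borel_preimage|exact: open_borel|].
  exact: preimage_subset.
apply: (le_trans (nu_le _ oV')).
apply: (@le_trans _ _ (image_capacity lam (g @^-1` V))%:E).
  by rewrite lee_fin.
have bgC : borel (g @` closure (g @^-1` V)).
  by apply: closed_borel; apply: image_closed; exact: closed_closure.
rewrite /image_capacity fineK; last exact: radon_fin.
apply: radon_mono => //; first exact: open_borel.
have cW : closed (g @^-1` (~` W)).
  by rewrite -preimage_setC; apply: open_closedC; move/continuousP : cg; exact.
have VCW : closure (g @^-1` V) `<=` g @^-1` (~` W).
  rewrite [X in _ `<=` X](proj1 (closure_id _) cW).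
  by apply: closure_subset; apply: preimage_subset; exact/disjoints_subset.
by move=> _ [t /VCW /= nW <-]; apply: contrapT => /OW.
Qed.

End lift.

(** * The image of the set of measures with large values on the U_i *)

Theorem lemma5p1 (R : realType) (K L : topologicalType)
    (cK : compact [set: K]) (hK : hausdorff_space K)
    (cL : compact [set: L]) (hL : hausdorff_space L)
    (g : K -> L) (cg : continuous g) (sg : set_surj [set: K] [set: L] g)
    (n : nat) (U : 'I_n -> set K)
    (clU : forall i, closed (U i)) (dU : trivIset [set: 'I_n] U)
    (c : 'I_n -> R) (c0 : forall i, (0 <= c i)%R) :
  radon_pushforward hL cg @`
    [set nu : radon_probability R K | forall i, (c i)%:E < nu (U i)] =
  [set lambda : radon_probability R L | forall A : {set 'I_n},
     A != finset.set0 ->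
     \sum_(i in A) (c i)%:E < lambda (g @` (\bigcup_(i in [set` A]) U i))].
Proof.
have cUA (A : {set 'I_n}) : closed (\bigcup_(i in [set` A]) U i).
  by apply: closed_bigcup => //; exact: finite_finset.
have cgUA (A : {set 'I_n}) := image_closed cK hL cg (cUA A).
apply/seteqP; split=> [_ [nu nuU <-] A A0|lam lamU].
  rewrite radon_pushforwardE; last exact: closed_borel.
  apply: (@lt_le_trans _ _ (nu (\bigcup_(i in [set` A]) U i))); last first.
    apply: radon_mono; first exact: closed_borel.
      by apply: (borel_preimage cg); exact: closed_borel.
    exact: preimage_image.
  rewrite radon_bigcup//.
  have fU i : nu (U i) = (fine (nu (U i)))%:E.
    by rewrite fineK// radon_fin//; exact: closed_borel.
  under [ltRHS]eq_bigr do rewrite fU.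
  rewrite !sumEFin lte_fin; apply: ltr_sum.
    by have /finset.set0Pn[i iA] := A0; apply/hasP; exists i; rewrite ?mem_index_enum.
  by move=> i _; rewrite -lte_fin -fU.
pose m0 := image_capacity g lam.
have m0U (A : {set 'I_n}) : (m0 (\bigcup_(i in [set` A]) U i))%:E =
    lam (g @` (\bigcup_(i in [set` A]) U i)) 
  by exact: image_capacityE.
have c_le (A : {set 'I_n}) : A != finset.set0 ->
    (\sum_(i in A) c i < m0 (\bigcup_(i in [set` A]) U i))%R.
  by move=> A0; rewrite -lte_fin m0U -sumEFin lamU.
have m0_cap : submodular_capacity m0 by exact: image_capacity_submodular.
have m0_0 : m0 (\bigcup_(i in [set` (finset.set0 : {set 'I_n})]) U i) = 0%R.
  rewrite (_ : bigcup _ _ = set0); first by case: m0_cap.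
  by apply: bigcup0 => i /=; rewrite finset.inE.
(* One t > 0 serves all A: adding t to each c_i adds t * #|A| to the sum. *)
have [||A|t /andP[t0 _] ht] := @exists_small_scale R {set 'I_n}
  (fun A => m0 (\bigcup_(i in [set` A]) U i) - \sum_(i in A) c i)%R
  (fun A => #|A|%:R)%R.
- move=> A; have [->|/c_le/ltW] := eqVneq A finset.set0.
    by rewrite m0_0 finset.big_set0 subrr.
  by rewrite subr_ge0.
- by move=> A; exact: ler0n.
- have [->|/c_le] := eqVneq A finset.set0; first by rewrite finset.cards0.
  by move=> + /subr0_eq E; rewrite E ltxx.
have hall : hall_condition U (fun i => c i + t)%R m0.
  move=> A; rewrite big_split/= sumr_const -mulr_natr.
  by have := ht A; lra.
have [m [m_cap m_mod mT m_le m_hall]] := exists_finitely_additive_minorant m0_cap hall.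
have [mz m_mono _] := m_cap.
have m0T : m0 setT = 1%R.
  apply: EFin_inj; rewrite (image_capacityE cK hL cg); last exact: closedT.
  by rewrite (_ : g @` setT = setT) ?radonT//; exact/seteqP.
have [y0 _] := radon_mass_probability lam.
have [x0 _ _] := sg y0 I.
have [nu [nu_closed nu_open]] :=
  exists_radon_of_finitely_additive cK hK x0 mz m_mono m_mod (etrans mT m0T).
exists nu; last exact: pushforward_of_dominated m_le nu_open.
move=> i /=; apply: lt_le_trans (nu_closed _ (clU i)).
have := m_hall [set i]%SET; rewrite finset.big_set1.
rewrite (_ : bigcup _ _ = U i); first by rewrite lte_fin; lra.
apply/seteqP; split=> [y [j /=]|y Uy]; first by rewrite finset.inE => /eqP ->.
by exists i => //=; rewrite finset.inE.
Qed.
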